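(* Let $m=2r+1$ be an odd positive integer, and let $X=(X(1),X(2),\dots,X(m))$ be a random vector taking values in $\{-1,1\}^m$, with law governed by a probability measure $\mathbb{P}$ (with expectation $\mathbb{E}$). Assume that $X$ and $-X$ have the same distribution. Let $A=\{\sigma\in\{-1,1\}^m:\sum_{i=1}^m\sigma(i)>0\}$ be the majority event, and for $i\in\{1,\dots,m\}$ let $$\kappa(i)=\mathbb{P}(X\in A\mid X(i)=1)-\mathbb{P}(X\in A\mid X(i)=-1)$$ be the conditional influence of voter $i$. Then $S=\sum_{i=1}^m X(i)$ satisfies $$\mathbb{E}|S|=\sum_{i=1}^m\kappa(i).$$ If, in addition, $X$ is symmetric, then $\kappa(i)$ does not depend on $i$ and, writing $\kappa$ for the common value, $\mathbb{E}|S|=m\kappa$.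
   Context: The components $X(i)$ are not assumed independent. The vector $X$ is called symmetric if (i) $X$ and $-X$ have the same distribution, and (ii) for all $i\neq j$ in $\{1,\dots,m\}$ there exists a permutation $\pi$ of $\{1,2,\dots,m\}$ with $\pi_i=j$ such that $X$ and $\pi X$ have the same distribution, where $\pi X=(X(\pi_1),X(\pi_2),\dots,X(\pi_m))$. Each $X(i)$ satisfies $\mathbb{P}(X(i)=1)=\mathbb{P}(X(i)=-1)=\tfrac12$ (this is implied by $X$ and $-X$ having the same distribution), so the conditional probabilities defining $\kappa(i)$ are well defined. *)

(* Defs.v *)
From HB Require Import structures.
From mathcomp Require Import all_boot all_order all_algebra perm.
From mathcomp Require Import all_classical all_reals all_analysis.

Set Implicit Arguments.
Unset Strict Implicit.
Unset Printing Implicit Defensive.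

Import Order.TTheory GRing.Theory Num.Theory.
Import numFieldNormedType.Exports.

Local Open Scope classical_set_scope.
Local Open Scope ring_scope.

Section vectors.
Context {R : realType} {m : nat}.
Implicit Types s : m.-tuple R.

Definition sign_vectors : set (m.-tuple R) :=
  [set s | forall i : 'I_m, tnth s i = -1 \/ tnth s i = 1].

Definition vote_sum s : R := \sum_(i < m) tnth s i.

Definition majority : set (m.-tuple R) :=
  [set s | sign_vectors s /\ 0 < vote_sum s].

Definition opp_vector s : m.-tuple R := [tuple - tnth s i | i < m].

Definition perm_vector (p : 'S_m) s : m.-tuple R := [tuple tnth s (p i) | i < m].

Lemma measurable_opp_vector : measurable_fun setT opp_vector.
Proof.
apply/measurable_fun_tnthP => i.
have -> : (tnth (T:=R) ^~ i) \o opp_vector = (fun s => - tnth s i).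
  by apply/funext => s /=; rewrite tnth_mktuple.
by apply: measurableT_comp => //; exact: measurable_tnth.
Qed.

Lemma measurable_perm_vector (p : 'S_m) : measurable_fun setT (perm_vector p).
Proof.
apply/measurable_fun_tnthP => i.
have -> : (tnth (T:=R) ^~ i) \o perm_vector p = (fun s => tnth s (p i)).
  by apply/funext => s /=; rewrite tnth_mktuple.
exact: measurable_tnth.
Qed.

HB.instance Definition _ :=
  isMeasurableFun.Build _ _ _ _ opp_vector measurable_opp_vector.
HB.instance Definition _ (p : 'S_m) :=
  isMeasurableFun.Build _ _ _ _ (perm_vector p) (measurable_perm_vector p).

End vectors.

Arguments sign_vectors : clear implicits.
Arguments majority : clear implicits.

Section laws.
Context {d : measure_display} {T : measurableType d} {R : realType}.
Variable P : probability T R.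

(* Only measurable sets count: a measure is a function on all sets, whose
   values on the nonmeasurable ones are irrelevant. *)
Definition same_distribution {d'} {T' : measurableType d'}
    (X Y : {RV P >-> T'}) : Prop :=
  forall B, measurable B -> distribution P X B = distribution P Y B.

Definition cond_prob (A B : set T) : R := fine (P (A `&` B)) / fine (P B).

Definition opp_invariant {m} (X : {RV P >-> m.-tuple R}) : Prop :=
  same_distribution X (opp_vector \o X).

Definition symmetric_vector {m} (X : {RV P >-> m.-tuple R}) : Prop :=
  opp_invariant X /\
  forall i j : 'I_m, i != j ->
    exists p : 'S_m, p i = j /\ same_distribution X (perm_vector p \o X).

Definition influence {m} (X : {RV P >-> m.-tuple R}) (i : 'I_m) : R :=
  cond_prob (X @^-1` majority R m) [set t | tnth (X t) i = 1] -
  cond_prob (X @^-1` majority R m) [set t | tnth (X t) i = -1].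

End laws.

(* Main.v *)
Require Import Defs.
From mathcomp Require Import all_boot all_order all_algebra perm.
From mathcomp Require Import all_classical all_reals all_analysis.
From mathcomp Require Import ring lra.

Import Order.TTheory GRing.Theory Num.Theory.
Import numFieldNormedType.Exports.

Local Open Scope classical_set_scope.
Local Open Scope ring_scope.

(** By invariance under negation each vote is fair, and the event that the
    majority is positive while voter [i] votes [-v] has the same probability as
    the event that it is negative while voter [i] votes [v]. Hence [influence X i]
    is the expectation of [sg (S) X(i)], and summing over [i] gives the
    expectation of [sg (S) S = |S|]. *)

Section tuples.
Context {R : realType} {m : nat}.
Implicit Types (s : m.-tuple R) (v : R).

Lemma measurable_vote_sum : measurable_fun setT (@vote_sum R m).
Proof. by apply: measurable_sum => i; exact: measurable_tnth. Qed.

Lemma vote_sum_opp s : vote_sum (opp_vector s) = - vote_sum s.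
Proof.
by rewrite /vote_sum -sumrN; apply: eq_bigr => i _; rewrite tnth_mktuple.
Qed.

Lemma vote_sum_perm (p : 'S_m) s : vote_sum (perm_vector p s) = vote_sum s.
Proof.
rewrite /vote_sum [RHS](reindex_inj (@perm_inj _ p)) /=.
by apply: eq_bigr => i _; rewrite tnth_mktuple.
Qed.

Definition vote_is (i : 'I_m) v : set (m.-tuple R) := [set s | tnth s i = v].
(** [majority] freed of its sign constraint: as the preimage of an open ray under [vote_sum] it is
    measurable at once. *)
Definition pos_sum : set (m.-tuple R) := [set s | 0 < vote_sum s].
Definition neg_sum : set (m.-tuple R) := [set s | vote_sum s < 0].

Lemma measurable_vote_is i v : measurable (vote_is i v).
Proof.
rewrite (_ : vote_is i v = setT `&` (@tnth m R ^~ i) @^-1` [set v]).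
  exact: measurable_tnth.
by rewrite setTI.
Qed.

Lemma measurable_pos_sum : measurable pos_sum.
Proof.
rewrite (_ : pos_sum = setT `&` (@vote_sum R m) @^-1` `]0, +oo[%classic).
  exact: measurable_vote_sum.
by rewrite setTI; apply/seteqP; split=> s /=; rewrite in_itv/= andbT.
Qed.

Lemma measurable_neg_sum : measurable neg_sum.
Proof.
rewrite (_ : neg_sum = setT `&` (@vote_sum R m) @^-1` `]-oo, 0[%classic).
  exact: measurable_vote_sum.
by rewrite setTI; apply/seteqP; split=> s /=; rewrite in_itv/=.
Qed.

(** Both sides depend only on the sign of the sum and on the vote, which leaves six cases; on a tie
    all four indicators vanish. In this form the integrand has an expectation that is a combination
    of four probabilities. *)
Lemma sg_mul_vote s i : tnth s i = -1 \/ tnth s i = 1 ->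
  Num.sg (vote_sum s) * tnth s i =
    (\1_(pos_sum `&` vote_is i 1) s - \1_(pos_sum `&` vote_is i (-1)) s)
    + (\1_(neg_sum `&` vote_is i (-1)) s - \1_(neg_sum `&` vote_is i 1) s).
Proof.
have neqN11 : (-1 == 1 :> R) = false by apply/eqP; lra.
have neq1N1 : (1 == -1 :> R) = false by apply/eqP; lra.
(* Each indicator becomes a boolean test on the sign of the sum and on the vote, which the case
   analysis below can evaluate. *)
have memE (b : bool) (v : R) (A : set (m.-tuple R)) : (s \in A) = b ->
    \1_(A `&` vote_is i v) s = (b && (tnth s i == v))%:R :> R.
  move=> <-; rewrite indicE in_setI; congr ((_ && _)%:R).
  by apply/idP/eqP => [/set_mem//|h]; exact/mem_set.
have posE : (s \in pos_sum) = (0 < vote_sum s).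
  by apply/idP/idP => [/set_mem//|h]; exact/mem_set.
have negE : (s \in neg_sum) = (vote_sum s < 0).
  by apply/idP/idP => [/set_mem//|h]; exact/mem_set.
rewrite !(memE _ _ _ posE) !(memE _ _ _ negE).
by case: (sgrP (vote_sum s)) => _ [] ->; rewrite ?eqxx ?neqN11 ?neq1N1/=; lra.
Qed.

Lemma norm_vote_sum s : `|vote_sum s| =
  \sum_(i < m) Num.sg (vote_sum s) * tnth s i.
Proof. by rewrite -mulr_sumr normrEsg. Qed.

End tuples.

#[local] Hint Extern 0 (measurable (vote_is _ _)) =>
  exact: measurable_vote_is : core.
#[local] Hint Extern 0 (measurable pos_sum) =>
  exact: measurable_pos_sum : core.
#[local] Hint Extern 0 (measurable neg_sum) =>
  exact: measurable_neg_sum : core.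

Section expectations.
Context {d : measure_display} {T : measurableType d} {R : realType}.
Variable P : probability T R.

Lemma integrable_signed_indic (A B C D : set T) :
  measurable A -> measurable B -> measurable C -> measurable D ->
  P.-integrable setT
    (EFin \o (fun t => (\1_A t - \1_B t) + (\1_C t - \1_D t) : R)).
Proof.
move=> mA mB mC mD.
have mAB := integrableB measurableT (integrable_indic P mA)
  (integrable_indic P mB).
have mCD := integrableB measurableT (integrable_indic P mC)
  (integrable_indic P mD).
exact: (integrableD measurableT mAB mCD).
Qed.

Lemma integral_signed_indic (A B C D : set T) :
  measurable A -> measurable B -> measurable C -> measurable D ->
  (\int[P]_t ((\1_A t - \1_B t) + (\1_C t - \1_D t) : R)%:E =
   ((fine (P A) - fine (P B)) + (fine (P C) - fine (P D)))%:E)%E.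
Proof.
move=> mA mB mC mD.
rewrite integralD_EFin//; last 2 first.
- exact: (integrableB measurableT (integrable_indic P mA)
    (integrable_indic P mB)).
- exact: (integrableB measurableT (integrable_indic P mC)
    (integrable_indic P mD)).
rewrite !integralB_EFin//; try exact: integrable_indic.
by rewrite !integral_indic// !setIT EFinD !EFinB !fineK// fin_num_measure.
Qed.

(** Meant for [Y] a transform of [X]: then [C] is the pullback of [B] under the transformation, and
    each use reduces to computing that pullback. *)
Lemma same_distribution_preimage {d'} {T' : measurableType d'}
    (X Y : {RV P >-> T'}) (B C : set T') :
  same_distribution X Y -> measurable B -> Y @^-1` B = X @^-1` C ->
  P (X @^-1` B) = P (X @^-1` C).
Proof. by move=> XY mB <-; exact: XY. Qed.

End expectations.

Section votes.
Context {d : measure_display} {T : measurableType d} {R : realType}.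
Context {P : probability T R} {m : nat} (X : {RV P >-> m.-tuple R}).
Hypothesis X_signs : forall t : T, X t \in sign_vectors R m.

Let prob (B : set (m.-tuple R)) : R := fine (P (X @^-1` B)).

Let X_meas (B : set (m.-tuple R)) : measurable B -> measurable (X @^-1` B).
Proof. by move=> mB; exact: measurable_funPTI. Qed.

Lemma sign_vote t i : tnth (X t) i = -1 \/ tnth (X t) i = 1.
Proof. by have /set_mem := X_signs t; apply. Qed.

(** All values of [X] are sign vectors, so [majority] and [pos_sum] have the same preimage. *)
Lemma influenceE i : influence X i =
  prob (pos_sum `&` vote_is i 1) / prob (vote_is i 1)
  - prob (pos_sum `&` vote_is i (-1)) / prob (vote_is i (-1)).
Proof.
have majE : X @^-1` majority R m = X @^-1` pos_sum.
  apply/seteqP; split=> t; first by case.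
  by move=> Xt; split => //; exact: set_mem (X_signs t).
by rewrite /influence /cond_prob majE.
Qed.

(** Permuting the votes keeps the sum and puts the vote of [p i] at position [i], so numerators and
    denominators agree separately. *)
Lemma influence_perm (p : 'S_m) i :
  same_distribution X (perm_vector p \o X) -> influence X i = influence X (p i).
Proof.
move=> Xp; have probE v : prob (vote_is i v) = prob (vote_is (p i) v).
  congr fine; apply: (same_distribution_preimage _ _ _ _ _ Xp) => //.
  by apply/seteqP; split=> t; rewrite /vote_is/= tnth_mktuple.
have pprobE v : prob (pos_sum `&` vote_is i v) =
                prob (pos_sum `&` vote_is (p i) v).
  congr fine; apply: (same_distribution_preimage _ _ _ _ _ Xp).
    exact: measurableI.
  by apply/seteqP; split=> t;
    rewrite /vote_is /pos_sum/= tnth_mktuple vote_sum_perm.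
by rewrite !influenceE !probE !pprobE.
Qed.

Hypothesis X_opp : opp_invariant X.

(** Negation swaps the two events, which are disjoint and cover the whole space, so each carries
    half of the mass. *)
Lemma prob_vote i v : v = 1 \/ v = -1 -> prob (vote_is i v) = 2^-1.
Proof.
have E : prob (vote_is i 1) = prob (vote_is i (-1)).
  congr fine; apply: (same_distribution_preimage _ _ _ _ _ X_opp) => //.
  apply/seteqP; split=> t; rewrite /vote_is/= tnth_mktuple; lra.
have : prob (vote_is i 1) + prob (vote_is i (-1)) = 1.
  apply: EFin_inj; rewrite EFinD !fineK ?fin_num_measure//; try exact: X_meas.
  rewrite -measureU//; try exact: X_meas; last first.
    by apply/seteqP; split=> // t; rewrite /vote_is/=; lra.
  rewrite -[RHS](@probability_setT _ _ _ P); congr (P _).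
  by apply/seteqP; split=> // t _; have [] := sign_vote t i; [right|left].
by move=> H [] ->; lra.
Qed.

Lemma prob_pos_neg i v :
  prob (pos_sum `&` vote_is i v) = prob (neg_sum `&` vote_is i (- v)).
Proof.
congr fine; apply: (same_distribution_preimage _ _ _ _ _ X_opp).
  exact: measurableI.
apply/seteqP; split=> t;
  rewrite /vote_is /pos_sum /neg_sum/= tnth_mktuple vote_sum_opp; lra.
Qed.

Let sg_voteE i : (fun t => Num.sg (vote_sum (X t)) * tnth (X t) i) =
  fun t => (\1_(X @^-1` (pos_sum `&` vote_is i 1)) t -
            \1_(X @^-1` (pos_sum `&` vote_is i (-1))) t) +
           (\1_(X @^-1` (neg_sum `&` vote_is i (-1))) t -
            \1_(X @^-1` (neg_sum `&` vote_is i 1)) t).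
Proof. by apply/funext => t; rewrite sg_mul_vote//; exact: sign_vote. Qed.

Lemma integrable_sg_vote i : P.-integrable setT
  (EFin \o (fun t => Num.sg (vote_sum (X t)) * tnth (X t) i)).
Proof.
rewrite sg_voteE.
by apply: integrable_signed_indic; apply: X_meas; exact: measurableI.
Qed.

Lemma expectation_sg_vote i :
  ('E_P[fun t => (Num.sg (vote_sum (X t)) * tnth (X t) i)%R] =
   (influence X i)%:E)%E.
Proof.
rewrite sg_voteE unlock integral_signed_indic;
  try by apply: X_meas; exact: measurableI.
congr EFin; rewrite -!/(prob _).
(* In terms of negative-sum events the two brackets coincide; the resulting factor 2 matches the
   division by the probability 1/2 of each vote. *)
rewrite influenceE (prob_pos_neg i 1) (prob_pos_neg i (-1)) opprK.
rewrite (prob_vote i 1 (or_introl erefl)) (prob_vote i (-1) (or_intror erefl)).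
by field.
Qed.

Lemma expectation_norm_vote_sum :
  ('E_P[fun t => `|vote_sum (X t)|%R] = (\sum_(i < m) influence X i)%R%:E)%E.
Proof.
rewrite unlock; under eq_integral do rewrite norm_vote_sum -sumEFin.
rewrite integral_sum//; last by move=> i; exact: integrable_sg_vote.
by rewrite -sumEFin; apply: eq_bigr => i _;
  rewrite -expectation_sg_vote unlock.
Qed.

End votes.

Theorem proposition2p5 (d : measure_display) (T : measurableType d)
    (R : realType) (P : probability T R) (r m : nat) (hm : m = (2 * r + 1)%N)
    (X : {RV P >-> m.-tuple R})
    (X_signs : forall t : T, X t \in sign_vectors R m)
    (X_opp : opp_invariant X) :
  ('E_P[fun t => `|vote_sum (X t)|%R] = (\sum_(i < m) influence X i)%R%:E)%E
  /\ (symmetric_vector X ->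
      exists kappa : R,
        (forall i : 'I_m, influence X i = kappa) /\
        ('E_P[fun t => `|vote_sum (X t)|%R] = (m%:R * kappa)%R%:E)%E).
Proof.
have ES := expectation_norm_vote_sum X X_signs X_opp.
split=> // -[_ X_sym].
(* Being odd, [m] is positive, so some voter [i0] exists to supply the common value. *)
have m_gt0 : (0 < m)%N by rewrite hm addn1.
pose i0 := Ordinal m_gt0.
have kappaE i : influence X i = influence X i0.
  (* Symmetry speaks of distinct indices only, hence the separate case [i = i0]; otherwise it gives
     [p] with [p i = i0]. *)
  have [->//|/X_sym[p [<- Xp]]] := eqVneq i i0.
  exact: influence_perm.
exists (influence X i0); split=> //.
rewrite ES (eq_bigr (fun=> influence X i0))//.
by rewrite sumr_const card_ord mulr_natl.
Qed.
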